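(* Let $X$ be a separable infinite-dimensional Banach space. Let $C\subseteq SP_\omega(X)$ be a non-empty set satisfying the following two conditions: (i) $C$ does not have a maximal element with respect to domination; (ii) for every sequence $(\tilde X_n)_{n\in\mathbb{N}}\subseteq C$ there exists $\tilde X\in C$ such that $\tilde X_n\le\tilde X$ for every $n\in\mathbb{N}$. Then for all $\alpha<\omega_1$ there exists $\tilde X^\alpha\in C$ such that $\tilde X^\alpha<\tilde X^\beta$ whenever $\alpha<\beta<\omega_1$.
   Context: Banach spaces are real. A seminormalized sequence $(x_i)$ in a Banach space has (generates) the spreading model $(\tilde x_i)$, where $(\tilde x_i)$ is a basic sequence in some Banach space, if for some sequence $\varepsilon_n\searrow 0$ one has, for all $n\in\mathbb{N}$, all $(a_i)_{i=1}^n\in[-1,1]^n$ and all integers $n\le k_1<\dots<k_n$, $$\left|\Big\|\sum_{i=1}^n a_i x_{k_i}\Big\|-\Big\|\sum_{i=1}^n a_i\tilde x_i\Big\|\right|<\varepsilon_n .$$ A basic sequence $(x_i)$ dominates $(y_i)$, written $(x_i)\ge(y_i)$ or $(y_i)\le(x_i)$, if there is $C\ge1$ with $C\|\sum a_ix_i\|\ge\|\sum a_iy_i\|$ for all finitely supported scalar sequences $(a_i)$; $(x_i)>(y_i)$ (or $(y_i)<(x_i)$) means $(x_i)\ge(y_i)$ and $(y_i)\not\ge(x_i)$. $SP_\omega(X)$ is the set of all spreading models generated by normalized weakly null basic sequences in $X$, with equivalent spreading models (those dominating each other) identified, partially ordered by domination. $\omega_1$ is the first uncountable ordinal. *)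

(* Defs.v *)
From HB Require Import structures.
From mathcomp Require Import all_boot all_order all_algebra.
From mathcomp Require Import all_classical all_reals all_analysis.
From mathcomp Require wochoice.

Set Implicit Arguments.
Unset Strict Implicit.
Unset Printing Implicit Defensive.

Import Order.TTheory GRing.Theory Num.Theory.
Import numFieldNormedType.Exports.

Local Open Scope classical_set_scope.
Local Open Scope ring_scope.

(* Sequences are indexed from 0: the term of index i >= 1 in the usual
   notation is here the term of index i.-1. *)

Section banach_space.
Context {R : realType}.

Definition separable_space (X : completeNormedModType R) : Prop :=
  exists D : set X, countable D /\ dense D.

Definition lin_span (X : completeNormedModType R) (x : nat -> X) : set X :=
  [set y | exists (n : nat) (a : nat -> R), y = \sum_(i < n) a i *: x i].

Definition infinite_dimensional (X : completeNormedModType R) : Prop :=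
  ~ exists (n : nat) (b : 'I_n -> X),
      forall y : X, exists a : 'I_n -> R, y = \sum_(i < n) a i *: b i.

(* A basic sequence is a Schauder basis of its closed linear span. *)
Definition basic (X : completeNormedModType R) (x : nat -> X) : Prop :=
  forall y : X, closure (lin_span x) y ->
    exists! a : nat -> R, series (fun i => a i *: x i) @ \oo --> y.

Definition normalized (X : completeNormedModType R) (x : nat -> X) : Prop :=
  forall i, `|x i| = 1.

Definition seminormalized (X : completeNormedModType R) (x : nat -> X) : Prop :=
  exists m M : R, 0 < m /\ forall i, m <= `|x i| <= M.

Definition weakly_null (X : completeNormedModType R) (x : nat -> X) : Prop :=
  forall f : {linear X -> R^o}, continuous f -> (f \o x) @ \oo --> (0 : R^o).

End banach_space.

Section domination.
Variable R : realType.

Record basic_seq := BasicSeq {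
  bs_space : completeNormedModType R;
  bs_seq :> nat -> bs_space;
  bs_basic : basic bs_seq }.

Definition dominates (x y : basic_seq) : Prop :=
  exists C : R, 1 <= C /\ forall (n : nat) (a : nat -> R),
    `|\sum_(i < n) a i *: y i| <= C * `|\sum_(i < n) a i *: x i|.

Definition equivalent (x y : basic_seq) : Prop :=
  dominates x y /\ dominates y x.

(* Since indices start at 0, the condition n <= k_1 < ... < k_n becomes
   n <= (k i).+1 with k strictly increasing. *)
Definition generates_spreading_model (X : completeNormedModType R)
    (x : nat -> X) (e : basic_seq) : Prop :=
  seminormalized x /\
  exists eps : nat -> R, [/\ nonincreasing_seq eps, eps @ \oo --> (0 : R) &
    forall (n : nat), (0 < n)%N -> forall (a : 'I_n -> R) (k : 'I_n -> nat),
      (forall i, -1 <= a i <= 1) ->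
      (forall i, (n <= (k i).+1)%N) ->
      (forall i j : 'I_n, (i < j)%N -> (k i < k j)%N) ->
      `| `|\sum_(i < n) a i *: x (k i)| - `|\sum_(i < n) a i *: e i| |
        < eps n].

Definition omega_spreading_model (X : completeNormedModType R)
    (e : basic_seq) : Prop :=
  exists x : nat -> X,
    [/\ normalized x, weakly_null x, basic x & generates_spreading_model x e].

(* A spreading model up to equivalence is the class of all the spreading models
   of X equivalent to it.  Classes are plain predicates because basic_seq
   quantifies over Banach spaces and hence lives in a universe above that of
   the library's [set]. *)
Definition sp_class := basic_seq -> Prop.

Definition SP_omega (X : completeNormedModType R) (S : sp_class) : Prop :=
  exists2 e, omega_spreading_model X e &
    S = (fun f => omega_spreading_model X f /\ equivalent e f).

Definition SP_le (S T : sp_class) : Prop :=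
  exists e f : basic_seq, [/\ S e, T f & dominates f e].

Definition SP_lt (S T : sp_class) : Prop := SP_le S T /\ ~ SP_le T S.

Definition SP_maximal (C : sp_class -> Prop) (M : sp_class) : Prop :=
  C M /\ forall T, C T -> ~ SP_lt M T.

Lemma dominates_trans (x y z : basic_seq) :
  dominates x y -> dominates y z -> dominates x z.
Proof.
move=> [C [C1 xy]] [D [D1 yz]]; exists (D * C); split.
  by rewrite -[1]mulr1 ler_pM.
move=> n a; apply: (le_trans (yz n a)); rewrite -mulrA ler_wpM2l //.
exact: le_trans D1.
Qed.

(* SP_le does not depend on the chosen representatives. *)
Lemma SP_leP (X : completeNormedModType R) (S T : sp_class) e f :
  SP_omega X S -> SP_omega X T -> S e -> T f ->
  SP_le S T <-> dominates f e.
Proof.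
move=> [e0 _ ->] [f0 _ ->] [eX [e0e ee0]] [fX [f0f ff0]]; split; last first.
  by move=> fe; exists e, f.
move=> [e' [f' [[_ [e0e' e'e0]] [_ [f0f' f'f0]] f'e']]].
exact: (dominates_trans ff0 (dominates_trans f0f' (dominates_trans f'e'
  (dominates_trans e'e0 e0e)))).
Qed.

End domination.

(* The order type of le is the first uncountable ordinal: a well-order on an
   uncountable type all of whose proper initial segments are countable.  The
   elements of W then stand for the ordinals below omega_1. *)
Definition order_type_omega1 (W : Type) (le : rel W) : Prop :=
  [/\ wochoice.well_order le, ~ countable [set: W] &
      forall b : W, countable [set a | le a b /\ a <> b]].

Lemma uncountable_set_nat : ~ countable [set: set nat].
Proof.
move=> /countable_injP[f finj].
pose D : set nat := [set n | exists2 A, f A = n & ~ A n].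
have DfD : D (f D) -> ~ D (f D).
  move=> [A fAD nA] DD; apply: nA.
  by rewrite (finj A D (mem_set I) (mem_set I) fAD).
have nD : ~ D (f D) by move=> h; exact: (DfD h).
by apply: (nD); exists D.
Qed.

Lemma order_type_omega1_exists :
  exists (W : Type) (le : rel W), order_type_omega1 le.
Proof.
have [le wo] := wochoice.well_ordering_principle (set nat : eqType).
pose I b := [set a | le a b /\ a <> b].
have [cI|/existsNP[b1 nI1]] := pselect (forall b, countable (I b)).
  by exists (set nat), le; split=> //; exact: uncountable_set_nat.
have [] := wo (fun b => `[< ~ countable (I b) >]).
  by exists b1; rewrite unfold_in; apply/asboolP.
move=> b [[]]; rewrite unfold_in => /asboolP nIb bmin _.
pose W := {a : set nat | `[< I b a >]}.
pose leW : rel W := fun u v => le (val u) (val v).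
have tot x y : le x y \/ le y x.
  have [] := wo (fun z => `[< z = x \/ z = y >]).
    by exists x; rewrite unfold_in; apply/asboolP; left.
  move=> z [[+ zmin] _]; rewrite unfold_in => /asboolP zxy.
  have zx := zmin x (asboolT (or_introl erefl)).
  have zy := zmin y (asboolT (or_intror erefl)).
  by case: zxy zx zy => -> *; [left|right].
have anti x y : le x y -> le y x -> x = y.
  move=> xy yx; have [] := wo (fun z => `[< z = x \/ z = y >]).
    by exists x; rewrite unfold_in; apply/asboolP; left.
  have lexx u : le u u by case: (tot u u).
  move=> z [_ zuniq]; transitivity z; last first.
    apply: zuniq; split; first by rewrite unfold_in; apply/asboolP; right.
    by move=> u; rewrite unfold_in => /asboolP[]->.
  apply/esym/zuniq; split; first by rewrite unfold_in; apply/asboolP; left.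
  by move=> u; rewrite unfold_in => /asboolP[]->.
exists W, leW; split.
- move=> A [w wA].
  have [] := wo (fun t => `[< exists2 v : W, v \in A & val v = t >]).
    by exists (val w); rewrite unfold_in; apply/asboolP; exists w.
  move=> t [[+ tmin] tuniq]; rewrite unfold_in => /asboolP[v vA vt].
  exists v; split.
    split=> // u uA; rewrite /leW vt; apply: tmin.
    by rewrite unfold_in; apply/asboolP; exists u.
  move=> u [uA umin]; apply: val_inj; rewrite /= vt; apply: tuniq; split.
    by rewrite unfold_in; apply/asboolP; exists u.
  by move=> s; rewrite unfold_in => /asboolP[r rA <-]; exact: umin.
- move=> /countable_injP[f finj]; apply: nIb; apply/countable_injP.
  pose g (a : set nat) : nat :=
    if pselect (I b a) is left h then f (exist _ a (asboolT h)) else 0%N.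
  exists g => x y; rewrite !in_setE /g => Ix Iy.
  case: pselect => // hx; case: pselect => // hy /finj.
  by rewrite !in_setE => /(_ Logic.I Logic.I)[].
- move=> w; have [lewb wb] : I b (val w) by exact/asboolP/(valP w).
  have cw : countable (I (val w)).
    apply: contrapT => nw; apply: wb; apply: anti => //; apply: bmin.
    by rewrite unfold_in; apply/asboolP.
  move/countable_injP: cw => [f finj]; apply/countable_injP.
  exists (f \o val) => x y; rewrite !in_setE => -[xw nx] [yw ny] /= fxy.
  apply/val_inj/finj => //; rewrite in_setE; split=> // e.
    by apply: nx; exact: val_inj.
  by apply: ny; exact: val_inj.
Qed.

(* Main.v *)
Require Import Defs.
From HB Require Import structures.
From mathcomp Require Import all_boot all_order all_algebra.
From mathcomp Require Import all_classical all_reals all_analysis.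
Import Order.TTheory GRing.Theory Num.Theory.
Import numFieldNormedType.Exports.
Local Open Scope classical_set_scope.
Local Open Scope ring_scope.

(** In a set of spreading models without a maximal element in which every
    sequence is bounded above, every sequence even has a strict upper bound:
    bound the sequence by some [T], and [T], not being maximal, lies strictly
    below some [T'] (lemma [sequence_strict_bound]).  An ordinal below omega_1
    has only countably many predecessors, so the spreading models already
    attached to them form a sequence, and a strict upper bound of that sequence
    can be attached to the ordinal itself.  This transfinite recursion is
    carried out in [omega1_chain], for an arbitrary relation
    on an arbitrary type in which every sequence has a strict upper bound. *)

Lemma well_order_wf (W : Type) (le : rel W) :
  wochoice.well_order le -> well_founded (fun a b => le a b /\ a <> b).
Proof.
move=> wo b; apply: contrapT => nacc.
pose bad : {pred W} := fun z => `[< ~ Acc (fun a b => le a b /\ a <> b) z >].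
have [|z [[/asboolP zbad zmin] _]] := wo bad; first by exists b; exact/asboolP.
apply: zbad; constructor=> y [yz yNz]; apply: contrapT => ybad; apply: yNz.
have zy : le z y by apply: zmin; exact/asboolP.
(* Both y and z are minima of {y, z}; antisymmetry is the uniqueness of the
   minimum. *)
have [|m [_ muniq]] := wo (fun x => `[< x = y \/ x = z >]).
  by exists y; apply/asboolP; left.
have lexx x : le x x.
  have [|t [[/asboolP-> tmin] _]] := wo (fun t => `[< t = x >]).
    by exists x; exact/asboolP.
  by apply: tmin; exact/asboolP.
have <- : m = y.
  by apply: muniq; split; [apply/asboolP; left|move=> x /asboolP[]->].
by apply: muniq; split; [apply/asboolP; right|move=> x /asboolP[]->].
Qed.

Section omega1_chains.
Context {D : Type} (lt : D -> D -> Prop) (d0 : D)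
  (seq_bound : forall u : nat -> D, exists d, forall n, lt (u n) d).

(** The family is only defined on [A] because the recursion below knows its
    values at the predecessors of an ordinal only. *)
Lemma countable_bound (W : Type) (A : set W) (f : forall a, A a -> D) :
  countable A -> exists d, forall a (Aa : A a), lt (f a Aa) d.
Proof.
move=> /countable_injP[g ginj].
have /choice[u uP] (n : nat) :
    exists d, forall a (Aa : A a), g a = n -> f a Aa = d.
  have [[a [Aa gan]]|none] := pselect (exists a, A a /\ g a = n).
    exists (f a Aa) => b Ab gbn.
    have ba : b = a by apply: ginj; rewrite ?in_setE// gbn.
    by subst b; rewrite (Prop_irrelevance Ab Aa).
  (* n is not the index of an element of A: any value will do. *)
  by exists d0 => a Aa gan; case: none; exists a.
have [d ud] := seq_bound u.
by exists d => a Aa; rewrite (uP _ a Aa erefl).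
Qed.

Lemma omega1_chain (W : Type) (le : rel W) : order_type_omega1 le ->
  exists f : W -> D, forall a b, le a b -> a <> b -> lt (f a) (f b).
Proof.
move=> [wo _ below_countable].
pose below a b := le a b /\ a <> b.
have next b (f : forall a, below a b -> D) :
    {d | forall a (ab : below a b), lt (f a ab) d}.
  exact/cid/countable_bound/below_countable.
pose step b f := proj1_sig (next b f).
exists (Fix (well_order_wf _ _ wo) (fun=> D) step) => a b ab aNb.
rewrite [X in lt _ X]Fix_eq; last first.
  move=> c f f' ff'; congr (step c _).
  by apply: functional_extensionality_dep => y; apply: funext => yc.
exact: (proj2_sig (next b _) a (conj ab aNb)).
Qed.

End omega1_chains.

(** Domination of classes is witnessed by some pair of representatives; the two
    witnesses need not share the representative of the middle class, and
    [SP_leP] replaces one by the other. *)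
Lemma SP_le_trans {R : realType} {X : completeNormedModType R}
    {S T U : sp_class R} :
  SP_omega X T -> SP_omega X U -> SP_le S T -> SP_le T U -> SP_le S U.
Proof.
move=> XT XU [e [f [Se Tf fe]]] TU.
have [f' [g [_ Ug _]]] := TU; exists e, g; split=> //.
by apply: dominates_trans fe; exact/(SP_leP XT XU Tf Ug).
Qed.

Lemma SP_le_lt_trans {R : realType} {X : completeNormedModType R}
    {S T U : sp_class R} :
  SP_omega X S -> SP_omega X T -> SP_omega X U ->
  SP_le S T -> SP_lt T U -> SP_lt S U.
Proof.
move=> XS XT XU ST [TU nUT]; split; first exact: (SP_le_trans XT XU ST TU).
by move=> US; apply: nUT; exact: (SP_le_trans XS XT US ST).
Qed.

Lemma sequence_strict_bound (R : realType) (X : completeNormedModType R)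
    (C : sp_class R -> Prop) :
  (forall S, C S -> SP_omega X S) ->
  ~ (exists M, SP_maximal C M) ->
  (forall u : nat -> sp_class R,
     (forall n, C (u n)) -> exists2 T, C T & forall n, SP_le (u n) T) ->
  forall u : nat -> sp_class R,
    (forall n, C (u n)) -> exists2 T, C T & forall n, SP_lt (u n) T.
Proof.
move=> CX nomax bnd u Cu; have [T CT uT] := bnd u Cu.
have [T' [CT' TT']] : exists T', C T' /\ SP_lt T T'.
  apply: contrapT => none; apply: nomax; exists T; split=> // T' CT' TT'.
  by apply: none; exists T'.
exists T' => // n.
by apply: (SP_le_lt_trans _ _ _ (uT n) TT'); exact: CX.
Qed.

Theorem proposition3p7 (R : realType) (X : completeNormedModType R)
  (X_separable : separable_space X)
  (X_infinite_dim : infinite_dimensional X)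
  (C : sp_class R -> Prop)
  (C_sub : forall S, C S -> SP_omega X S)
  (C_nonempty : exists S, C S)
  (C_no_maximal : ~ exists M, SP_maximal C M)
  (C_seq_bounded : forall u : nat -> sp_class R,
     (forall n, C (u n)) -> exists2 T, C T & forall n, SP_le (u n) T)
  (W : Type) (le : rel W) (W_omega1 : order_type_omega1 le) :
  exists Xt : W -> sp_class R,
    (forall a, C (Xt a)) /\
    (forall a b : W, le a b -> a <> b -> SP_lt (Xt a) (Xt b)).
Proof.
have [S0 CS0] := C_nonempty.
(* The recursion takes place in the type of the elements of C, so that the
   bounds obtained remain in C. *)
have bound (u : nat -> {S | C S}) :
    exists d : {S | C S}, forall n, SP_lt (proj1_sig (u n)) (proj1_sig d).
  have [T CT uT] := sequence_strict_bound _ _ _ C_sub C_no_maximal C_seq_bounded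
    _ (fun n => proj2_sig (u n)).
  by exists (exist _ T CT).
have [f fP] := omega1_chain (fun S T => SP_lt (proj1_sig S) (proj1_sig T))
  (exist _ S0 CS0) bound _ _ W_omega1.
by exists (fun a => proj1_sig (f a)); split=> // a; exact: proj2_sig.
Qed.
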